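(* Let $a_1<0$, and let $\{Z_i\}_{i\ge0}$ be the AR(1) process $Z_i=a_1Z_{i-1}+\xi_i$, $i\ge1$, where $\{\xi_i\}_{i\ge1}$ are i.i.d. standard exponential random variables independent of $Z_0$, and $Z_0$ has an arbitrary law $\mu$ on $\mathbb{R}$. Then for every integer $n\ge1$, $$\mathbb{P}\Big(\min_{0\le i\le n}Z_i\ge0\Big)=\Big(\frac1{1-a_1}\Big)^{n-1}\,\mathbb{E}\big[e^{a_1Z_0}1_{\{Z_0\ge0\}}\big].$$
   Context: The standard exponential distribution has density $e^{-y}$ on $(0,\infty)$. *)

(* Defs.v *)
From mathcomp Require Import all_boot all_order all_algebra.
From mathcomp Require Import finmap.
From mathcomp Require Import all_classical all_reals all_analysis.

Set Implicit Arguments.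
Unset Strict Implicit.
Unset Printing Implicit Defensive.

Import Order.TTheory GRing.Theory Num.Theory.
Local Open Scope classical_set_scope.
Local Open Scope ring_scope.

Definition mutually_independent (d : measure_display) (T : measurableType d)
    (R : realType) (P : probability T R) (I : choiceType) (D : set I)
    (X : I -> {RV P >-> R}) : Prop :=
  forall (J : {fset I}) (B : I -> set R),
    [set` J] `<=` D ->
    (forall j, j \in J -> measurable (B j)) ->
    P (\bigcap_(j in [set` J]) X j @^-1` B j) =
    (\prod_(j <- J) P (X j @^-1` B j))%E.

Definition sigma_generated (d : measure_display) (T : measurableType d)
    (R : realType) (P : probability T R) (I : Type) (D : set I)
    (X : I -> {RV P >-> R}) : set (set T) :=
  <<s \bigcup_(i in D) preimage_set_system setT (X i) measurable >>.

(* Y is independent of the whole family (X i)_{i in D}, i.e. sigma(Y) and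
   sigma(X i, i in D) are independent (not merely Y and each X i separately). *)
Definition independent_of_family (d : measure_display) (T : measurableType d)
    (R : realType) (P : probability T R) (Y : {RV P >-> R})
    (I : Type) (D : set I) (X : I -> {RV P >-> R}) : Prop :=
  forall A B : set T,
    preimage_set_system setT Y measurable A -> sigma_generated D X B ->
    P (A `&` B) = (P A * P B)%E.

(* Main.v *)
(* Write b = - a1, A_k = {Z_0, ..., Z_k >= 0} and e_k(s) = E[1_(A_k) exp(- s Z_k)].
   Since Z_(k+1) = xi_(k+1) - b Z_k, the event A_(k+1) says that A_k holds and that
   xi_(k+1) exceeds the level b Z_k >= 0, and Z_(k+1) is then the overshoot.  As
   xi_(k+1) is exponential and independent of (Z_0, ..., Z_k), the overshoot is
   memoryless: e_(k+1)(s) = e_k(b) / (1 + s).  Taking s = b iterates down to e_0(b),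
   and s = 0 gives P(A_(k+1)) = e_k(b). *)
Require Import Defs.
From HB Require Import structures.
From mathcomp Require Import all_boot all_order all_algebra.
From mathcomp Require Import finmap.
From mathcomp Require Import all_classical all_reals all_analysis.
From mathcomp Require Import measurable_realfun ring.
Import Order.TTheory GRing.Theory Num.Theory.
Import HBNNSimple numFieldNormedType.Exports.
Set Implicit Arguments.
Unset Strict Implicit.
Local Open Scope classical_set_scope.
Local Open Scope ring_scope.

(** * Independence passes from a pi-system to its sigma-algebra *)

Lemma independent_generated (R : realType) (d : measure_display)
    (T : measurableType d) (P : probability T R) (G : set (set T)) (E : set T) :
  measurable E -> setI_closed G -> G `<=` measurable ->
  (forall A, G A -> P (A `&` E) = (P A * P E)%E) ->
  forall A, <<s G >> A -> P (A `&` E) = (P A * P E)%E.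
Proof.
move=> mE GI Gm GE A sGA.
(* Dynkin's pi-lambda theorem: the events independent of [E] form a lambda-system that contains the
   pi-system [G]. *)
suff: <<s G >> `<=` [set B | measurable B /\ P (B `&` E) = (P B * P E)%E].
  by move=> /(_ _ sGA)[].
apply: lambda_system_subset => //; last first.
  by move=> B GB; split; [exact: Gm|exact: GE].
apply/dynkin_lambda_system; split => /=.
- by split => //; rewrite setTI probability_setT mul1e.
- move=> B [mB PB]; split; first exact: measurableC.
  rewrite setIC -setDE measureD//.
  rewrite (setIC E) [X in (_ - X)%E]PB probability_setC//.
  rewrite muleBl ?fin_num_measure//.
    by rewrite mul1e.
  by rewrite ltey_eq fin_num_measure.
- move=> F tF HF.
  have mF n : measurable (F n) by have [] := HF n.
  split; first exact: bigcup_measurable.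
  rewrite setI_bigcupl measure_semi_bigcup//; last 3 first.
  + by move=> n; exact: measurableI.
  + exact: trivIset_setIr.
  + by apply: bigcup_measurable => n _; exact: measurableI.
  rewrite [in RHS]measure_semi_bigcup//; last exact: bigcup_measurable.
  rewrite muleC -(fineK (fin_num_measure P E mE)) -nneseriesZl//.
  apply: eq_eseriesr => n _; rewrite fineK ?fin_num_measure// muleC.
  by have [] := HF n.
Qed.

(** * Integration against a density and against an independent pair *)

Lemma ge0_integral_density (R : realType) (d : measure_display)
    (T : measurableType d) (mu nu : {measure set T -> \bar R})
    (p : T -> R) :
  measurable_fun setT p -> (forall x, 0 <= p x) ->
  (forall A, measurable A -> nu A = \int[mu]_(x in A) (p x)%:E)%E ->
  forall f : T -> \bar R, measurable_fun setT f -> (forall x, 0 <= f x)%E ->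
  (\int[nu]_x f x = \int[mu]_x (f x * (p x)%:E))%E.
Proof.
move=> mp p0 nuE f mf f0.
have mpE : measurable_fun setT (EFin \o p) by exact/measurable_EFinP.
(* The usual three stages: indicators, then simple functions by linearity, then monotone limits. *)
have indic (A : set T) : measurable A ->
    (\int[nu]_x (\1_A x)%:E = \int[mu]_x ((\1_A x)%:E * (p x)%:E))%E.
  move=> mA; rewrite integral_indic// setIT nuE// integral_mkcond.
  by apply: eq_integral => x _; rewrite patchE indicE; case: ifPn => xA;
    rewrite ?mul1e ?mul0e.
have nnsfun (g : {nnsfun T >-> R}) :
    (\int[nu]_x (g x)%:E = \int[mu]_x ((g x)%:E * (p x)%:E))%E.
  under [LHS]eq_integral do rewrite fimfunE -fsumEFin//.
  rewrite [LHS]ge0_integral_fsum//; last 2 first.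
    by move=> r; exact/measurable_EFinP/measurableT_comp.
    by move=> n x _; rewrite EFinM nnfun_muleindic_ge0.
  under [RHS]eq_integral.
    move=> x xD; rewrite fimfunE -fsumEFin// muleC ge0_mule_fsumr; last first.
      by move=> r; rewrite EFinM nnfun_muleindic_ge0.
    over.
  rewrite [RHS]ge0_integral_fsum//; last 2 first.
    move=> r; apply: emeasurable_funM => //.
    by apply/measurable_EFinP; do 2 apply/measurableT_comp => //.
    by move=> n x _; apply: mule_ge0;
      [rewrite lee_fin|exact: nnfun_muleindic_ge0].
  apply: eq_fsbigr => r _; rewrite integralZl_indic_nnsfun//= indic//.
  have [r0|r0] := leP 0 r.
    rewrite -ge0_integralZl//=; last 2 first.
      by apply: emeasurable_funM => //; exact/measurable_EFinP.
      by move=> x _; rewrite mule_ge0// lee_fin.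
    by apply: eq_integral => x _; rewrite EFinM [RHS]muleC muleA.
  (* A negative [r] has empty preimage under [g], so both terms vanish. *)
  rewrite preimage_nnfun0// indic0 !integral0_eq ?mule0//= => x _;
    by rewrite ?mulr0 ?mule0 ?mul0e.
pose f_ := nnsfun_approx measurableT mf.
transitivity (limn (fun n => \int[nu]_x (f_ n x)%:E))%E.
  rewrite -monotone_convergence//=.
  - apply: eq_integral => ? _; apply/esym/cvg_lim => //=.
    exact: cvg_nnsfun_approx.
  - by move=> n; exact/measurable_EFinP/measurable_funTS.
  - by move=> n ? _; rewrite lee_fin.
  - by move=> ? _ ? ? mn; rewrite lee_fin; exact/lefP/nd_nnsfun_approx.
under eq_fun do rewrite nnsfun.
rewrite -monotone_convergence//=.
- apply: eq_integral => x _; apply/cvg_lim => //=.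
  by apply: cvgeZr => //; exact: cvg_nnsfun_approx.
- move=> n; apply: emeasurable_funM => //.
  exact/measurable_EFinP/measurable_funTS.
- by move=> n ? _; rewrite mule_ge0// lee_fin.
- move=> ? _ ? ? mn; rewrite lee_wpmul2r// ?lee_fin//.
  exact/lefP/nd_nnsfun_approx.
Qed.

(** Independence says that the joint law agrees with the product of the marginal laws on rectangles,
    hence everywhere by uniqueness of the product measure; Tonelli then integrates over the second
    coordinate first. *)
Lemma ge0_integral_independent (R : realType) (d d1 d2 : measure_display)
    (T : measurableType d) (S1 : measurableType d1) (S2 : measurableType d2)
    (P : probability T R) (X : {RV P >-> S1}) (Y : {RV P >-> S2}) :
  (forall A B, measurable A -> measurable B ->
    P (X @^-1` A `&` Y @^-1` B) = (P (X @^-1` A) * P (Y @^-1` B))%E) ->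
  forall f : S1 * S2 -> \bar R, measurable_fun setT f ->
    (forall z, 0 <= f z)%E ->
  (\int[P]_w f (X w, Y w) =
   \int[P]_w \int[distribution P Y]_y f (X w, y))%E.
Proof.
move=> indep f mf f0.
have mXY : measurable_fun setT (fun w => (X w, Y w)).
  exact: measurable_fun_pair.
pose XY : {mfun T >-> (S1 * S2)%type} := HB.pack (fun w => (X w, Y w))
  (isMeasurableFun.Build _ _ _ _ _ mXY).
transitivity (\int[distribution P X \x distribution P Y]_z f z)%E; last first.
  rewrite fubini_tonelli1// ge0_integral_distribution//.
    exact: measurable_fun_fubini_tonelli_F.
  by move=> x; apply: integral_ge0.
transitivity (\int[distribution P XY]_z f z)%E.
  by rewrite ge0_integral_distribution.
apply: eq_measure_integral => A mA _; apply/esym/product_measure_unique => //.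
Qed.

(** * Independence of one variable from [Y] and a finite block of the family *)

Definition cylinders (T S1 S2 : Type) (G1 : set (set S1)) (G2 : set (set S2))
    (I : choiceType) (J : {fset I}) (Y : T -> S1) (X : I -> T -> S2) :
    set (set T) :=
  [set A | exists B0 B, [/\ G1 B0, forall j, G2 (B j) &
    A = Y @^-1` B0 `&` \bigcap_(j in [set` J]) X j @^-1` B j]].

Lemma setI_closed_cylinders (T S1 S2 : Type)
    (G1 : set (set S1)) (G2 : set (set S2))
    (I : choiceType) (J : {fset I}) (Y : T -> S1) (X : I -> T -> S2) :
  setI_closed G1 -> setI_closed G2 -> setI_closed (cylinders G1 G2 J Y X).
Proof.
move=> I1 I2 _ _ [B0 [B [mB0 mB ->]]] [C0 [C [mC0 mC ->]]].
exists (B0 `&` C0), (fun j => B j `&` C j); split; [exact: I1| |].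
  by move=> j; exact: I2.
by rewrite setIACA -bigcapI preimage_setI.
Qed.

Lemma cylinders_measurable (d d1 d2 : measure_display) (T : measurableType d)
    (S1 : measurableType d1) (S2 : measurableType d2)
    (I : choiceType) (J : {fset I}) (Y : {mfun T >-> S1})
    (X : I -> {mfun T >-> S2}) :
  cylinders measurable measurable J Y X `<=` measurable.
Proof.
move=> _ [C0 [C [mC0 mC ->]]]; apply: measurableI.
  exact: measurable_funPTI.
by apply: fin_bigcap_measurable => // j _; exact: measurable_funPTI.
Qed.

(** The cylinders form a pi-system generating sigma([Y], [X j] for [j] in [J]), so it suffices to
    factor the probability on them: [indepY] splits off the factor of [Y], and [indepX] splits the
    rest. *)
Lemma independent_cylinders (R : realType) (d : measure_display)
    (T : measurableType d) (P : probability T R) (I : choiceType) (D : set I)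
    (X : I -> {RV P >-> R}) (Y : {RV P >-> R}) (J : {fset I}) (k : I) :
  mutually_independent D X -> independent_of_family Y D X ->
  [set` J] `<=` D -> D k -> k \notin J ->
  forall A B, <<s cylinders measurable measurable J Y X >> A -> measurable B ->
  P (A `&` X k @^-1` B) = (P A * P (X k @^-1` B))%E.
Proof.
move=> indepX indepY JD Dk kJ A B sA mB.
apply: independent_generated sA => {A}.
- exact: measurable_funPTI.
- by apply: setI_closed_cylinders; exact: measurableI.
- exact: cylinders_measurable.
move=> _ [C0 [C [mC0 mC ->]]].
have YX (K : {fset I}) (C' : I -> set R) : [set` K] `<=` D ->
    (forall j, measurable (C' j)) ->
    P (Y @^-1` C0 `&` \bigcap_(j in [set` K]) X j @^-1` C' j) =
    (P (Y @^-1` C0) * \prod_(j <- K) P (X j @^-1` C' j))%E.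
  move=> KD mC'; rewrite indepY.
  - by rewrite (indepX K) // => j _; exact: mC'.
  - by exists C0 => //; rewrite setTI.
  rewrite /sigma_generated.
  apply: (@fin_bigcap_measurable _ (g_sigma_algebraType _)) => // j /KD Dj.
  apply: sub_sigma_algebra; exists j => //.
  by exists (C' j) => //; rewrite setTI.
(* Placing [B] at index [k] turns the cylinder cut by [X k @^-1] B[into a cylinder over]k |[J]; as
   [k] is not in [J], the other constraints are unchanged. *)
pose C' j := if j == k then B else C j.
have mC' j : measurable (C' j) by rewrite /C'; case: ifP.
have C'E j : j \in J -> C' j = C j.
  by move=> jJ; rewrite /C'; case: eqP => // jk; rewrite -jk jJ in kJ.
have kJD : [set` (k |` J)%fset] `<=` D.
  by move=> j /=; rewrite !inE => /orP[/eqP -> //|]; exact: JD.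
have := YX (k |` J)%fset C' kJD mC'.
rewrite set_fsetU set_fset1 bigcap_setU bigcap_set1.
rewrite (_ : C' k = B); last by rewrite /C' eqxx.
rewrite (eq_bigcapr (G := fun j => X j @^-1` C j)); last first.
  by move=> j /C'E ->.
rewrite (setIC (X k @^-1` B)) setIA => ->.
rewrite big_fsetU1//= YX//.
rewrite (_ : C' k = B); last by rewrite /C' eqxx.
rewrite (eq_big_seq (fun j => P (X j @^-1` C j))); last by move=> j /C'E ->.
by rewrite muleCA muleC.
Qed.

(** * The overshoot of an exponential variable *)

Lemma integral_exponential_tail (R : realType) (nu : probability R R)
    (c s : R) :
  (forall A, measurable A -> nu A = exponential_prob 1 A) ->
  0 <= c -> 0 <= s ->
  (\int[nu]_y (\1_`[c, +oo[ y * expR (- (s * (y - c))))%:E =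
   (expR (- c) / (1 + s))%:E)%E.
Proof.
move=> nuE c0 s0.
have s1 : 0 < 1 + s by rewrite ltr_pwDl.
have s1N0 : 1 + s != 0 by rewrite gt_eqF.
have mexp : measurable_fun setT (fun y : R => expR (- (s * (y - c)))).
  apply: measurableT_comp => //; apply: measurableT_comp => //.
  by apply: measurable_funM => //; exact: measurable_funB.
pose g (y : measurableTypeR R) : \bar R :=
  (\1_`[c, +oo[ y * expR (- (s * (y - c))))%:E.
have g0 y : (0 <= g y)%E by rewrite lee_fin mulr_ge0// expR_ge0.
have mg : measurable_fun setT g.
  by apply/measurable_EFinP; apply: measurable_funM.
(* The Lebesgue measure lives on [measurableTypeR R], whose display is not that
   of [R]: transport [nu] along the identity. *)
have mid : measurable_fun setT (id : R -> measurableTypeR R).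
  by move=> _ B mB; rewrite setTI.
pose phi : {mfun R >-> measurableTypeR R} :=
  HB.pack (id : R -> measurableTypeR R) (isMeasurableFun.Build _ _ _ _ _ mid).
transitivity (\int[distribution nu phi]_y g y)%E.
  by rewrite ge0_integral_distribution.
pose nu' : {measure set (measurableTypeR R) -> \bar R} := distribution nu phi.
have nuE' (A : set (measurableTypeR R)) : measurable A ->
    (nu' A = \int[lebesgue_measure]_(x in A) (exponential_pdf 1 x)%:E)%E.
  exact: nuE.
rewrite (@ge0_integral_density R _ (measurableTypeR R) lebesgue_measure nu'
  (exponential_pdf 1) _ _ nuE')//; last 2 first.
- exact: measurable_exponential_pdf.
- by move=> y; exact: exponential_pdf_ge0.
(* The product of [expR (- (s * (y - c)))] and the density; since [0 <= c], the density is
   [expR (- y)] on all of the half-line from [c]. *)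
pose f (y : R) := expR (s * c - (1 + s) * y).
rewrite (_ : (\int[_]_x _)%E =
    (\int[lebesgue_measure]_(y in `[c, +oo[) (f y)%:E)%E); last first.
  rewrite [RHS]integral_mkcond; apply: eq_integral => y _.
  rewrite patchE /g indicE; case: ifPn => yc; last by rewrite mul0r mul0e.
  rewrite mul1r -EFinM exponential_pdfE; last first.
    by move: yc; rewrite inE/= in_itv/= andbT; exact: le_trans.
  by rewrite mul1r -expRD /f; congr (expR _)%:E; ring.
(* An antiderivative of [f] that vanishes at infinity, so the integral is [- F c]. *)
pose F y := - (f y / (1 + s)).
have cf : continuous f.
  move=> y; apply: (@continuous_comp R^o R^o R^o); last exact: continuous_expR.
  by apply: cvgB; [exact: cvg_cst|apply: cvgMl_tmp; exact: cvg_id].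
have dF (y : R) : is_derive y (1 : R) F (f y).
  rewrite /F /f; apply: is_derive_eq.
  rewrite /GRing.scale/=.
  by field.
rewrite (@ge0_continuous_FTC2y _ f F c 0).
- by rewrite sub0e -EFinN opprK /f; congr (expR _ / _)%:E; ring.
- by move=> y _; exact: expR_ge0.
- exact: continuous_subspaceT.
- have -> : F = (fun y => - (expR (s * c) / (1 + s)) * expR (- ((1 + s) * y))).
    by apply/funext => y; rewrite /F /f expRD; field.
  rewrite -(mulr0 (- (expR (s * c) / (1 + s)))); apply: cvgMl_tmp.
  apply: (@cvg_comp _ _ _ (fun y => (1 + s) * y) (fun z => expR (- z)) _
    (pinfty_nbhs R)); last exact: cvgr_expR.
  exact: gt0_cvgMry.
- by move=> y _; exact: ex_derive.
- apply/cvg_at_right_filter; apply: cvgN; apply: cvgMr_tmp; exact: cf.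
- by move=> y _; rewrite derive1E derive_val.
Qed.

(** The level [c] is known from [<<s G >>], of which [X] is independent, so it can be frozen while
    [X] is integrated out. The tail integral at this fixed level gives [expR (- c w) / (1 + s)]. *)
Lemma expectation_exponential_overshoot (R : realType) (d : measure_display)
    (T : measurableType d) (P : probability T R) (G : set (set T))
    (X : {RV P >-> R}) (A : set T) (c : T -> R) (s : R) :
  (forall B, measurable B -> distribution P X B = exponential_prob 1 B) ->
  G `<=` measurable ->
  (forall B C, <<s G >> B -> measurable C ->
    P (B `&` X @^-1` C) = (P B * P (X @^-1` C))%E) ->
  <<s G >> A -> measurable_fun setT (c : g_sigma_algebraType G -> R) ->
  (forall w, A w -> 0 <= c w) -> 0 <= s ->
  ('E_P[(fun w => \1_[set w | A w /\ c w <= X w] w *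
     expR (- (s * (X w - c w))))%R] =
   'E_P[(fun w => \1_A w * expR (- c w))%R] * ((1 + s)^-1)%:E)%E.
Proof.
move=> Xexp Gm indep sA mc c0 s0.
have sGm B : <<s G >> B -> measurable B.
  by apply: smallest_sub => //; exact: sigma_algebra_measurable.
(* Independence of [X] from [<<s G >>] is independence of [X] from the identity
   seen as a random variable valued in the coarser measurable space. *)
have mid : measurable_fun setT (id : T -> g_sigma_algebraType G).
  by move=> _ B mB; rewrite setTI; exact: sGm.
pose Id : {RV P >-> g_sigma_algebraType G} :=
  HB.pack (id : T -> g_sigma_algebraType G)
    (isMeasurableFun.Build _ _ _ _ _ mid).
(* The factor [\1_A] is kept apart: off [A], where [c] may be negative, it makes the inner integral
   zero. *)
pose f (z : g_sigma_algebraType G * R) : \bar R :=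
  (\1_A z.1 * (\1_[set z | c z.1 <= z.2] z * expR (- (s * (z.2 - c z.1)))))%:E.
have mc1 : measurable_fun setT (fun z : g_sigma_algebraType G * R => c z.1).
  exact: measurableT_comp.
have mf : measurable_fun setT f.
  apply/measurable_EFinP; apply: measurable_funM.
    by apply: measurableT_comp => //; exact: measurable_indic.
  apply: measurable_funM.
    apply: measurable_indic; rewrite -[X in measurable X]setTI.
    exact: measurable_fun_le.
  apply: measurableT_comp => //; apply: measurableT_comp => //.
  by apply: measurable_funM => //; exact: measurable_funB.
have f0 z : (0 <= f z)%E by rewrite lee_fin !mulr_ge0// expR_ge0.
rewrite unlock.
transitivity (\int[P]_w f (Id w, X w))%E.
  apply: eq_integral => w _; rewrite /f/= mulrA; congr (_ * _)%:E.
  rewrite !indicE -natrM mulnb; congr (nat_of_bool _)%:R.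
  by apply/idP/andP; rewrite !inE.
rewrite (ge0_integral_independent (X := Id))//.
rewrite muleC -ge0_integralZl//; last 2 first.
- apply/measurable_EFinP; apply: measurable_funM.
    by apply: measurable_indic; exact: sGm.
  apply: measurableT_comp => //; apply: measurableT_comp => //.
  exact: (measurableT_comp mc mid).
- by rewrite lee_fin invr_ge0 addr_ge0.
apply: eq_integral => w _.
have [wA|wA] := boolP (w \in A); last first.
  rewrite indicE (negbTE wA) mul0r mule0 integral0_eq// => y _.
  by rewrite /f/= indicE (negbTE wA) mul0r.
rewrite indicE wA mul1r -EFinM mulrC.
rewrite -(integral_exponential_tail (nu := distribution P X))//; last first.
  by apply: c0; rewrite inE in wA.
apply: eq_integral => y _; rewrite /f/= !indicE wA mul1r; congr (_%:R * _)%:E.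
by congr nat_of_bool; apply/idP/idP; rewrite !inE/= in_itv/= andbT.
Qed.

(** * Recursion along the chain *)

Theorem proposition3p6 (R : realType) (d : measure_display)
    (T : measurableType d) (P : probability T R)
    (a1 : R) (mu : probability R R)
    (Z xi : nat -> {RV P >-> R})
    (a1_lt0 : a1 < 0)
    (Z_rec : forall (i : nat) (w : T), (1 <= i)%N ->
      Z i w = a1 * Z (i - 1)%N w + xi i w)
    (xi_indep : mutually_independent [set i : nat | (1 <= i)%N] xi)
    (xi_exp : forall (i : nat) (A : set R), (1 <= i)%N -> measurable A ->
      distribution P (xi i) A = exponential_prob 1 A)
    (Z0_indep : independent_of_family (Z 0%N) [set i : nat | (1 <= i)%N] xi)
    (Z0_law : forall A : set R, measurable A ->
      distribution P (Z 0%N) A = mu A)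
    (n : nat) (n_ge1 : (1 <= n)%N) :
  P [set w | 0 <= \big[Num.min/Z 0%N w]_(0 <= i < n.+1) Z i w] =
  (((1 / (1 - a1)) ^+ (n - 1))%:E *
   'E_P[(fun w => expR (a1 * Z 0%N w) * \1_[set w' | 0 <= Z 0%N w'] w)%R])%E.
Proof.
pose A k : set T := [set w | forall i, (i <= k)%N -> 0 <= Z i w].
pose b : R := - a1.
pose e k (s : R) := 'E_P[(fun w => \1_(A k) w * expR (- (s * Z k w)))%R]%E.
have AE k : A k = \bigcap_(i in `I_k.+1) Z i @^-1` `[0, +oo[%classic.
  by apply/seteqP; split=> w h i /h; rewrite /= in_itv/= andbT.
have AS k : A k.+1 = [set w | A k w /\ - (a1 * Z k w) <= xi k.+1 w].
  have ZS w : (0 <= Z k.+1 w) = (- (a1 * Z k w) <= xi k.+1 w).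
    by rewrite Z_rec// subn1/= addrC -lerBlDr sub0r.
  apply/seteqP; split=> w /=.
    by move=> h; rewrite -ZS; split; [move=> i /leqW; exact: h|exact: h].
  by move=> [h]; rewrite -ZS => h' i; rewrite leq_eqVlt => /predU1P[->//|/h].
have step k (s : R) : 0 <= s -> e k.+1 s = (e k b * ((1 + s)^-1)%R%:E)%E.
  move=> s0.
  (* [J] is {1, ..., k}, so that [G] generates the past sigma(Z_0, xi_1, ..., xi_k), which leaves
     out xi_(k+1). *)
  pose J : {fset nat} := [fset j in iota 1 k]%fset.
  have JE j : (j \in J) = (0 < j <= k)%N by rewrite !inE mem_iota add1n ltnS.
  pose G := cylinders measurable measurable J (Z 0%N) xi.
  pose S := g_sigma_algebraType G.
  have mxi j : j \in J -> measurable_fun setT (xi j : S -> R).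
    (* The event that [xi j] lies in [B] is a cylinder whose only constraint is the one at [j]. *)
    move=> jJ _ B mB; apply: sub_sigma_algebra.
    exists setT, (fun i => if i == j then B else setT); split => //.
      by move=> i; case: ifP.
    rewrite preimage_setT; congr (_ `&` _); apply/seteqP; split=> w /=.
      by move=> Bw i /= _; case: eqP => // ->.
    by move=> /(_ j jJ); rewrite /= eqxx.
  (* By the recurrence, Z_i depends only on Z_0, xi_1, ..., xi_i; the bound [i <= k] keeps these
     indices in [J]. *)
  have mZ i : (i <= k)%N -> measurable_fun setT (Z i : S -> R).
    elim: i => [_|i IH ik].
      move=> _ B mB; apply: sub_sigma_algebra.
      exists B, (fun=> setT); split => //.
      by rewrite setTI; apply/seteqP; split=> w /=; [split|case].
    rewrite (_ : (Z i.+1 : S -> R) = fun w => a1 * Z i w + xi i.+1 w).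
      apply: measurable_funD; last by apply: mxi; rewrite JE ik.
      by apply: measurable_funM => //; exact: (IH (ltnW ik)).
    by apply/funext => w; rewrite Z_rec// subn1.
  pose c (w : T) := - (a1 * Z k w).
  rewrite /e AS.
  (* Z_(k+1) is rewritten as the overshoot of xi_(k+1) over the level [c]. *)
  under [in LHS]eq_fun.
    move=> w; rewrite Z_rec// subn1/= (_ : a1 * _ + _ = xi k.+1 w - c w).
      over.
    by rewrite /c opprK addrC.
  rewrite (@expectation_exponential_overshoot _ _ _ _ G)//.
  - by congr (_ * _)%E; rewrite /c /b; under [in RHS]eq_fun do rewrite mulNr.
  - by move=> B mB; exact: xi_exp.
  - exact: cylinders_measurable.
  - apply: (independent_cylinders xi_indep Z0_indep) => //.
    + by move=> j /=; rewrite JE => /andP[].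
    + by rewrite JE ltnn andbF.
  - rewrite AE; apply: (@bigcap_measurable _ S) => [|i /= ik].
      by exists 0%N.
    by rewrite -[X in measurable X]setTI; exact: mZ.
  - apply: measurable_funN; apply: measurable_funM => //; exact: mZ.
  (* The sign of [a1] enters here: Z_k is nonnegative on A_k, hence so is the level. *)
  - by move=> w Aw; rewrite /c oppr_ge0 nmulr_rle0// Aw.
(* At [s = b] the factor of [step] is 1 / (1 + b) = 1 / (1 - a1). *)
have eE k : e k b = (((1 / (1 - a1)) ^+ k)%:E * e 0%N b)%E.
  elim: k => [|k IH]; first by rewrite expr0 mul1e.
  rewrite step ?oppr_ge0 ?ltW// IH exprS EFinM muleC muleA div1r.
  by [].
case: n n_ge1 => // k _; rewrite subSS subn0.
(* With n = k + 1, the last step is taken at [s = 0] and contributes the factor 1, which is why the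
   exponent is n - 1. *)
transitivity (e k.+1 0).
  rewrite /e (_ : (fun w => _) = \1_(A k.+1)); last first.
    by apply/funext => w; rewrite mul0r oppr0 expR0 mulr1.
  rewrite expectation_indic.
    congr (P _); apply/seteqP; split=> w /=.
      (* The default value [Z 0] of the minimum is also one of its terms, so it adds no
         constraint. *)
      rewrite big_mkord => /bigmin_geP[_ h] i ik.
      exact: (h (Ordinal (ik : (i < k.+2)%N))).
    move=> h; rewrite big_mkord; apply: le_bigmin; first exact: h.
    by move=> i _; apply: h; rewrite -ltnS.
  rewrite AE; apply: bigcap_measurable => [|i _]; first by exists 0%N.
  exact: measurable_funPTI.
rewrite step// addr0 invr1 mule1 eE; congr (_ * _)%E.
congr ('E_P[_])%E; apply/funext => w; rewrite mulrC mulNr opprK; congr (_ * _).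
congr (\1_ _ w); apply/seteqP; split=> v /=; first exact.
by move=> h i; rewrite leqn0 => /eqP ->.
Qed.
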